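(* Let $A,B$ be positive definite matrices and let $t\in[-1,\tfrac12]$ with $t\neq0$. Then \[ A\,\widehat{sp}_t\,B\prec_{\log}\left(A^{\frac{1-t}{2t}}BA^{\frac{1-t}{2t}}\right)^t. \]
   Context: For positive definite matrices $A,B$ and $t\in\mathbb{R}$: $A\sharp B:=A^{1/2}(A^{-1/2}BA^{-1/2})^{1/2}A^{1/2}$ and $A\,\widehat{sp}_t\,B:=(A^{-1}\sharp B)^tA(A^{-1}\sharp B)^t$. For $n\times n$ positive semidefinite matrices $X,Y$ with eigenvalues $\lambda_1(\cdot)\ge\dots\ge\lambda_n(\cdot)$, $X\prec_{\log}Y$ means $\prod_{j=1}^k\lambda_j(X)\le\prod_{j=1}^k\lambda_j(Y)$ for $k=1,\dots,n-1$ and $\det X=\det Y$. *)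

(* Defs.v *)
From HB Require Import structures.
From mathcomp Require Import all_boot all_order all_algebra.
From mathcomp Require Import complex.
From mathcomp Require Import boolp reals exp.
Set Implicit Arguments. Unset Strict Implicit. Unset Printing Implicit Defensive.
Import Order.TTheory GRing.Theory Num.Theory.
Local Open Scope ring_scope.
Local Open Scope complex_scope.

Section MatDefs.
Variable R : realType.
Local Notation C := R[i].

Definition adjmx {m n} (A : 'M[C]_(m, n)) : 'M[C]_(n, m) := (map_mx Num.conj A)^T.

Definition hermitian {n} (A : 'M[C]_n) : Prop := adjmx A = A.

Definition unitarymx {n} (U : 'M[C]_n) : Prop := U *m adjmx U = 1%:M.

Definition posdef {n} (A : 'M[C]_n) : Prop :=
  hermitian A /\ forall v : 'cV[C]_n, v != 0 -> 0 < (adjmx v *m A *m v) 0 0.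

Definition rdiag {n} (d : 'I_n -> R) : 'M[C]_n :=
  diag_mx (\row_i ((d i)%:C)).

Definition mpow_spec {n} (A : 'M[C]_n) (r : R) (X : 'M[C]_n) : Prop :=
  exists (U : 'M[C]_n) (d : 'I_n -> R),
    [/\ unitarymx U, (forall i, 0 < d i),
        A = U *m rdiag d *m adjmx U &
        X = U *m rdiag (fun i => powR (d i) r) *m adjmx U].

Definition mpow {n} (A : 'M[C]_n) (r : R) : 'M[C]_n :=
  match pselect (exists X, mpow_spec A r X) with
  | left h => projT1 (cid h)
  | right _ => A
  end.

Definition gmean {n} (A B : 'M[C]_n) : 'M[C]_n :=
  mpow A (1/2) *m mpow (mpow A (-(1/2)) *m B *m mpow A (-(1/2))) (1/2) *m mpow A (1/2).

Definition spt {n} (t : R) (A B : 'M[C]_n) : 'M[C]_n :=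
  mpow (gmean (invmx A) B) t *m A *m mpow (gmean (invmx A) B) t.

Definition eigen_desc {n} (X : 'M[C]_n) (d : 'I_n -> R) : Prop :=
  (forall i j : 'I_n, (i <= j)%N -> d j <= d i) /\
  char_poly X = \prod_(i < n) ('X - ((d i)%:C)%:P).

Definition eigval {n} (X : 'M[C]_n) : 'I_n -> R :=
  match pselect (exists d, eigen_desc X d) with
  | left h => projT1 (cid h)
  | right _ => fun _ => 0
  end.

Definition logmaj {n} (X Y : 'M[C]_n) : Prop :=
  (forall k : nat, (1 <= k <= n.-1)%N ->
     \prod_(j < n | (j < k)%N) eigval X j <= \prod_(j < n | (j < k)%N) eigval Y j)
  /\ \det X = \det Y.

End MatDefs.

(* Main.v *)
(* Write G = A^-1 # B = A^(-1/2) Q^(1/2) A^(-1/2) with Q = A^(1/2) B A^(1/2), and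
   p = (1 - t) / (2 t).  Compound matrices are multiplicative (Cauchy-Binet) and
   commute with real powers, hence with both sides of the claim, and the largest
   eigenvalue of the k-th compound of X is the product of the k largest
   eigenvalues of X.  By homogeneity in B it therefore suffices to show that
   (A^p B A^p)^t <= 1 implies G^t A G^t <= 1.

   For 0 < t <= 1/2 the hypothesis reads Q <= A^u with u = 2 - 1/t.  Taking
   square roots gives G <= A^(-1/(2t)), and the Loewner-Heinz inequality with
   exponent 2t gives G^(2t) <= A^-1.

   For t = -s < 0 it reads A^u <= Q.  With a = 1/u = s/(2s+1), Loewner-Heinz gives
   A <= Q^a and A^(u-1) <= Q^(1-a), whence
     G^2 = A^(-1/2) Q^(1/2) A^-1 Q^(1/2) A^(-1/2)
        >= A^(-1/2) Q^(1-a) A^(-1/2) >= A^(u-2) = A^(1/s),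
   and Loewner-Heinz with exponent s <= 1 gives G^(2s) >= A.

   The Loewner-Heinz inequality holds on a set of exponents that contains 0 and
   1, is closed under midpoints, and is closed by continuity. *)
From HB Require Import structures.
From mathcomp Require Import all_boot all_order all_fingroup all_algebra.
From mathcomp Require Import complex.
From mathcomp Require Import boolp reals topology normedtype sequences exp.
From mathcomp Require Import ring lra.
Require Import Defs.
Set Implicit Arguments. Unset Strict Implicit. Unset Printing Implicit Defensive.
Import Order.TTheory GRing.Theory Num.Theory.
Import numFieldNormedType.Exports.
Local Open Scope ring_scope.
Local Open Scope complex_scope.
Local Open Scope sesquilinear_scope.

(** * Unitary diagonalization and well-defined real powers *)

Section RealPowers.
Variable R : realType.
Local Notation C := R[i].

Lemma adjmxM m n p (A : 'M[C]_(m, n)) (B : 'M[C]_(n, p)) :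
  adjmx (A *m B) = adjmx B *m adjmx A.
Proof. by rewrite /adjmx map_mxM trmx_mul. Qed.

Lemma adjmxK m n (A : 'M[C]_(m, n)) : adjmx (adjmx A) = A.
Proof. by apply/matrixP=> i j; rewrite !mxE conjCK. Qed.

Lemma adjmxB m n (A B : 'M[C]_(m, n)) : adjmx (A - B) = adjmx A - adjmx B.
Proof. by apply/matrixP=> i j; rewrite !mxE rmorphB. Qed.

Lemma adjmx1 n : adjmx (1%:M : 'M[C]_n) = 1%:M.
Proof. by rewrite /adjmx map_mx1 trmx1. Qed.

Lemma conj_realC (x : R) : Num.conj (x%:C) = x%:C.
Proof. by apply/CrealP/complex_realP; exists x. Qed.

Lemma rdiagE n (d : 'I_n -> R) i j : rdiag d i j = ((d i)%:C) *+ (i == j).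
Proof. by rewrite !mxE. Qed.

Lemma adjmx_rdiag n (d : 'I_n -> R) : adjmx (rdiag d) = rdiag d.
Proof.
apply/matrixP=> i j; rewrite 2!mxE !rdiagE [j == i]eq_sym.
by case: eqP => [->|_]; rewrite ?mulr1n ?mulr0n ?conj_realC ?rmorph0.
Qed.

Lemma mul_rdiag n (d e : 'I_n -> R) :
  rdiag d *m rdiag e = rdiag (fun i => d i * e i).
Proof.
apply/matrixP=> i j; rewrite /rdiag mul_diag_mx !mxE.
by case: eqP => _; rewrite ?mulr1n ?mulr0n ?mulr0 // rmorphM.
Qed.

Lemma rdiag1 n (d : 'I_n -> R) : d =1 (fun=> 1) -> rdiag d = 1%:M.
Proof. by move=> d1; apply/matrixP=> i j; rewrite rdiagE d1 mxE. Qed.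

Lemma eq_rdiag n (d e : 'I_n -> R) : d =1 e -> rdiag d = rdiag e.
Proof. by move=> de; apply/matrixP=> i j; rewrite !rdiagE de. Qed.

Lemma unitarymx_adjl n (U : 'M[C]_n) : Defs.unitarymx U -> adjmx U *m U = 1%:M.
Proof. exact: mulmx1C. Qed.

Definition udiag n (U : 'M[C]_n) (d : 'I_n -> R) : 'M[C]_n :=
  U *m rdiag d *m adjmx U.

Lemma adjmx_udiag n (U : 'M[C]_n) d : adjmx (udiag U d) = udiag U d.
Proof. by rewrite /udiag !adjmxM adjmxK adjmx_rdiag mulmxA. Qed.

Lemma mul_udiag n (U : 'M[C]_n) d e : Defs.unitarymx U ->
  udiag U d *m udiag U e = udiag U (fun i => d i * e i).
Proof.
move=> /unitarymx_adjl UU; rewrite /udiag -!mulmxA (mulmxA (adjmx U) U) UU mul1mx.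
by rewrite [rdiag d *m _]mulmxA mul_rdiag !mulmxA.
Qed.

Lemma udiag1 n (U : 'M[C]_n) d : Defs.unitarymx U -> d =1 (fun=> 1) ->
  udiag U d = 1%:M.
Proof. by move=> Uu d1; rewrite /udiag rdiag1 // mulmx1 Uu. Qed.

Lemma eq_udiag n (U : 'M[C]_n) d e : d =1 e -> udiag U d = udiag U e.
Proof. by move=> de; rewrite /udiag (eq_rdiag de). Qed.

(* The entries of [adjmx V *m U] intertwine the two diagonals, hence vanish
   unless the corresponding eigenvalues agree. *)
Lemma udiag_fun n (U V : 'M[C]_n) (d e : 'I_n -> R) (f : R -> R) :
  Defs.unitarymx U -> Defs.unitarymx V ->
  udiag U d = udiag V e -> udiag U (f \o d) = udiag V (f \o e).
Proof.
move=> Uu Vu E.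
have UU := unitarymx_adjl Uu; have VV := unitarymx_adjl Vu.
pose W := adjmx V *m U.
have WE : W *m rdiag d = rdiag e *m W.
  have : adjmx V *m (udiag U d) *m U = adjmx V *m (udiag V e) *m U by rewrite E.
  rewrite /udiag -!mulmxA UU mulmx1 => ->.
  by rewrite (mulmxA (adjmx V) V) VV mul1mx.
have WF : W *m rdiag (f \o d) = rdiag (f \o e) *m W.
  apply/matrixP=> i j; move/matrixP: WE => /(_ i j).
  rewrite /rdiag !mul_mx_diag !mul_diag_mx !mxE.
  set w := (\sum_k _) => wE.
  have [-> | w0] := eqVneq w 0; first by rewrite mul0r mulr0.
  move: wE; rewrite mulrC => /(mulIf w0) /complexI /= ->.
  by rewrite mulrC.
have UE : U = V *m W by rewrite /W mulmxA Vu mul1mx.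
rewrite /udiag {1}UE -[V *m W *m _]mulmxA WF -!mulmxA; congr (_ *m (_ *m _)).
by rewrite /W -?mulmxA Uu mulmx1.
Qed.

(** [mpow] picks some diagonalization by choice; [udiag_fun] shows that every diagonalization yields
    the same power, so the given one may be used. *)
Lemma mpow_udiag n (U : 'M[C]_n) d r : Defs.unitarymx U -> (forall i, 0 < d i) ->
  mpow (udiag U d) r = udiag U (fun i => powR (d i) r).
Proof.
move=> Uu d0; rewrite /mpow; case: pselect => [h|]; last first.
  by case; exists (udiag U (fun i => powR (d i) r)), U, d.
case: (cid h) => /= X [V [e [Vu e0 E ->]]].
exact: (esym (udiag_fun (fun x => powR x r) Uu Vu E)).
Qed.

(** In the coordinates [w = adjmx U *m v] the form is the sum of the [|w_j|^2 d_j], and some [w_j]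
    is nonzero. *)
Lemma posdef_udiag n (U : 'M[C]_n) d : Defs.unitarymx U -> (forall i, 0 < d i) ->
  posdef (udiag U d).
Proof.
move=> Uu d0; split; first exact: adjmx_udiag.
move=> v v0; pose w := adjmx U *m v.
have vE : v = U *m w by rewrite /w mulmxA Uu mul1mx.
have w0 : w != 0 by apply: contraNneq v0 => w0; rewrite vE w0 mulmx0.
have -> : adjmx v *m udiag U d *m v = adjmx w *m rdiag d *m w.
  by rewrite /udiag /w adjmxM adjmxK !mulmxA.
have [i wi0] : exists i, w i 0 != 0.
  apply/existsP; apply: contraNT w0 => /existsPn wi.
  by apply/eqP/colP=> i; rewrite [RHS]mxE; apply/eqP/negbNE/wi.
have term j : adjmx w 0 j * (d j)%:C * w j 0 = `|w j 0| ^+ 2 * (d j)%:C.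
  by rewrite !mxE normCK; ring.
rewrite mxE /rdiag; under eq_bigr => j _ do rewrite mul_mx_diag mxE [X in _ * X * _]mxE term.
rewrite (bigD1 i) //= ltr_pwDl //.
  by rewrite mulr_gt0 ?exprn_gt0 ?normr_gt0 // ltcR.
by apply: sumr_ge0 => j _; rewrite mulr_ge0 ?exprn_ge0 // lecR ltW.
Qed.

Lemma posdef_spectral n (A : 'M[C]_n) : posdef A ->
  exists (U : 'M[C]_n) (d : 'I_n -> R),
    [/\ Defs.unitarymx U, (forall i, 0 < d i) & A = udiag U d].
Proof.
move=> [Ah Apos].
have An : A \is normalmx.
  apply/normalmxP; have -> : A ^t* = adjmx A by rewrite /adjmx map_trmx.
  by rewrite Ah.
have Pu := spectral_unitarymx A.
move/orthomx_spectralP: An; rewrite invmx_unitary //.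
set P := spectralmx A in Pu *; set D := spectral_diag A => AE.
have adjP : P ^t* = adjmx P by rewrite /adjmx map_trmx.
rewrite adjP in AE.
have PP : P *m adjmx P = 1%:M by rewrite -adjP; apply/unitarymxP.
have Uu : Defs.unitarymx (adjmx P) by rewrite /Defs.unitarymx adjmxK; exact: mulmx1C.
(* The form of [A] at the eigenvector [adjmx P *m delta_mx i 0] equals the eigenvalue [D 0 i]; being
   positive in [C], it is real, so taking [Re] below loses nothing. *)
have D0 i : 0 < D 0 i.
  have [v Pv] : exists v : 'cV[C]_n, P *m v = delta_mx i 0.
    by exists (adjmx P *m delta_mx i 0); rewrite mulmxA PP mul1mx.
  have v0 : v != 0.
    apply/eqP => v0; move: Pv; rewrite v0 mulmx0 => /matrixP /(_ i 0).
    by rewrite !mxE !eqxx => /eqP; rewrite eq_sym oner_eq0.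
  have := Apos v v0.
  have -> : adjmx v *m A *m v = adjmx (P *m v) *m diag_mx D *m (P *m v).
    by rewrite [in LHS]AE adjmxM !mulmxA.
  rewrite Pv -mulmxA mul_diag_mx mxE (bigD1 i) //= big1 ?addr0.
    by rewrite !mxE !eqxx /= rmorph1 mul1r mulr1.
  by move=> j ji; rewrite !mxE (negbTE ji) /= rmorph0 mul0r.
exists (adjmx P), (fun i => complex.Re (D 0 i)); split=> //.
  by move=> i; have := D0 i; rewrite ltcE /= => /andP[].
rewrite /udiag adjmxK {1}AE; congr (_ *m _ *m _).
rewrite /rdiag; congr diag_mx; apply/rowP=> i; rewrite mxE RRe_real //.
by rewrite ger0_real // ltW.
Qed.

End RealPowers.

(* Locking keeps unification from unfolding [mpow] down to the spectral
   decompositions, which makes rewriting prohibitively slow. *)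
HB.lock Definition rpow {R : realType} {n} (A : 'M[R[i]]_n) (r : R) := mpow A r.

Lemma mpowE (R : realType) n (A : 'M[R[i]]_n) r : mpow A r = rpow A r.
Proof. by rewrite unlock. Qed.

Lemma rpow_udiag (R : realType) n (U : 'M[R[i]]_n) d r :
  Defs.unitarymx U -> (forall i, 0 < d i) ->
  rpow (udiag U d) r = udiag U (fun i => powR (d i) r).
Proof. by rewrite unlock; exact: mpow_udiag. Qed.

(** * Exponent laws, scaling, congruences and determinants of powers *)

Section RealPowersTheory.
Variable R : realType.
Local Notation C := R[i].

Lemma rpow_posdef n (A : 'M[C]_n) r : posdef A -> posdef (rpow A r).
Proof.
move=> /posdef_spectral [U [d [Uu d0 ->]]]; rewrite rpow_udiag //.
by apply: posdef_udiag => // i; rewrite powR_gt0.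
Qed.

Lemma adjmx_rpow n (A : 'M[C]_n) r : posdef A -> adjmx (rpow A r) = rpow A r.
Proof. by move=> /(rpow_posdef r) []. Qed.

Lemma rpowD n (A : 'M[C]_n) r s : posdef A ->
  rpow A r *m rpow A s = rpow A (r + s).
Proof.
move=> /posdef_spectral [U [d [Uu d0 ->]]]; rewrite !rpow_udiag // mul_udiag //.
by apply: eq_udiag => i; rewrite powRD // (gt_eqF (d0 i)) implybT.
Qed.

Lemma rpow0 n (A : 'M[C]_n) : posdef A -> rpow A 0 = 1%:M.
Proof.
move=> /posdef_spectral [U [d [Uu d0 ->]]]; rewrite rpow_udiag //.
by apply: udiag1 => // i; rewrite powRr0.
Qed.

Lemma rpow1 n (A : 'M[C]_n) : posdef A -> rpow A 1 = A.
Proof.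
move=> /posdef_spectral [U [d [Uu d0 ->]]]; rewrite rpow_udiag //.
by apply: eq_udiag => i; rewrite powRr1 // ltW.
Qed.

Lemma rpowM n (A : 'M[C]_n) r s : posdef A -> rpow (rpow A r) s = rpow A (r * s).
Proof.
move=> /posdef_spectral [U [d [Uu d0 ->]]]; rewrite !rpow_udiag //.
  by apply: eq_udiag => i; rewrite powRrM.
by move=> i; rewrite powR_gt0.
Qed.

Lemma scale_udiag n (U : 'M[C]_n) d c :
  c%:C *: udiag U d = udiag U (fun i => c * d i).
Proof.
rewrite /udiag scalemxAl scalemxAr; congr (_ *m _ *m _).
by apply/matrixP=> i j; rewrite mxE !rdiagE rmorphM mulrnAr.
Qed.

Lemma rpowZ n (A : 'M[C]_n) c r : posdef A -> 0 < c ->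
  rpow (c%:C *: A) r = (powR c r)%:C *: rpow A r.
Proof.
move=> /posdef_spectral [U [d [Uu d0 ->]]] c0.
rewrite scale_udiag !rpow_udiag // ?scale_udiag.
  by apply: eq_udiag => i; rewrite powRM // ltW.
by move=> i; rewrite mulr_gt0.
Qed.

Lemma posdefZ n (A : 'M[C]_n) c : posdef A -> 0 < c -> posdef (c%:C *: A).
Proof.
move=> /posdef_spectral [U [d [Uu d0 ->]]] c0; rewrite scale_udiag.
by apply: posdef_udiag => // i; rewrite mulr_gt0.
Qed.

Lemma rpowK n (A : 'M[C]_n) r : posdef A -> rpow A r *m rpow A (- r) = 1%:M.
Proof. by move=> Ap; rewrite rpowD // subrr rpow0. Qed.

Lemma rpowVK n (A : 'M[C]_n) r : posdef A -> rpow A (- r) *m rpow A r = 1%:M.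
Proof. by move=> Ap; rewrite rpowD // addNr rpow0. Qed.

Lemma rpow_unit n (A : 'M[C]_n) r : posdef A -> rpow A r \in unitmx.
Proof. by move=> Ap; case: (mulmx1_unit (rpowK r Ap)). Qed.

Lemma posdef_unit n (A : 'M[C]_n) : posdef A -> A \in unitmx.
Proof. by move=> Ap; rewrite -(rpow1 Ap) rpow_unit. Qed.

Lemma invmx_posdef n (A : 'M[C]_n) : posdef A -> invmx A = rpow A (-1).
Proof.
move=> Ap; rewrite -[RHS](mulKmx (posdef_unit Ap)) -{3}(rpow1 Ap).
by rewrite rpowK // mulmx1.
Qed.

Lemma posdef_congr n (A M : 'M[C]_n) : posdef A -> M \in unitmx ->
  posdef (adjmx M *m A *m M).
Proof.
move=> [Ah Ap] Mu; split.
  by rewrite /hermitian !adjmxM adjmxK Ah mulmxA.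
move=> v v0; have Mv0 : M *m v != 0.
  by apply: contraNneq v0 => Mv0; rewrite -(mulKmx Mu v) Mv0 mulmx0.
by have := Ap _ Mv0; rewrite adjmxM !mulmxA.
Qed.

Lemma posdef_congr_rpow n (A P : 'M[C]_n) r : posdef A -> posdef P ->
  posdef (rpow P r *m A *m rpow P r).
Proof.
move=> Ap Pp; rewrite -{1}(adjmx_rpow r Pp).
by apply: posdef_congr => //; exact: rpow_unit.
Qed.

Lemma unitarymx_det n (U : 'M[C]_n) : Defs.unitarymx U -> \det U * \det (adjmx U) = 1.
Proof. by move=> Uu; rewrite -det_mulmx Uu det1. Qed.

Lemma det_udiag n (U : 'M[C]_n) d : Defs.unitarymx U ->
  \det (udiag U d) = (\prod_i d i)%:C.
Proof.
move=> Uu; rewrite /udiag !det_mulmx mulrAC unitarymx_det // mul1r det_diag.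
by rewrite rmorph_prod; apply: eq_bigr => i _; rewrite mxE.
Qed.

Lemma prod_powR (I : finType) (F : I -> R) r : (forall i, 0 <= F i) ->
  \prod_i powR (F i) r = powR (\prod_i F i) r.
Proof.
(* Nonnegativity of the partial product is carried along because [powRM] requires it. *)
move=> F0; suff [] : 0 <= \prod_i F i /\ \prod_i powR (F i) r = powR (\prod_i F i) r by [].
elim/big_rec2: _ => [|i x y _ [y0 ->]]; first by rewrite powR1.
by rewrite mulr_ge0 // powRM.
Qed.

Lemma det_rpow n (A : 'M[C]_n) : posdef A -> exists2 a : R, 0 < a &
  \det A = a%:C /\ forall r, \det (rpow A r) = (powR a r)%:C.
Proof.
move=> /posdef_spectral [U [d [Uu d0 ->]]]; exists (\prod_i d i).
  exact: prodr_gt0.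
split=> [|r]; first exact: det_udiag.
rewrite rpow_udiag // det_udiag //; congr (_ %:C).
by apply: prod_powR => i; exact: ltW.
Qed.

End RealPowersTheory.

(** * The Loewner order through quadratic forms *)

Section LoewnerOrder.
Variable R : realType.
Local Notation C := R[i].

Definition qform n (A : 'M[C]_n) (v : 'cV[C]_n) : C := (adjmx v *m A *m v) 0 0.

(** The Loewner order. Comparison in [C] also demands equal imaginary parts, so the difference of
    the forms is real. *)
Definition lemx n (A B : 'M[C]_n) := forall v, qform A v <= qform B v.

Lemma lemx_refl n (A : 'M[C]_n) : lemx A A.
Proof. by move=> v. Qed.

Lemma lemx_trans n (B A D : 'M[C]_n) : lemx A B -> lemx B D -> lemx A D.
Proof. by move=> AB BD v; exact: le_trans (BD v). Qed.

Lemma qformB n (A B : 'M[C]_n) v : qform (A - B) v = qform A v - qform B v.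
Proof. by rewrite /qform mulmxBr mulmxBl !mxE. Qed.

Lemma qformD n (A B : 'M[C]_n) v : qform (A + B) v = qform A v + qform B v.
Proof. by rewrite /qform mulmxDr mulmxDl !mxE. Qed.

Lemma qformZ n (A : 'M[C]_n) c v : qform (c *: A) v = c * qform A v.
Proof. by rewrite /qform -scalemxAr -scalemxAl !mxE. Qed.

Lemma qform_congr n (A M : 'M[C]_n) v :
  qform (adjmx M *m A *m M) v = qform A (M *m v).
Proof. by rewrite /qform adjmxM !mulmxA. Qed.

Lemma lemx_congr n (A B M : 'M[C]_n) : lemx A B ->
  lemx (adjmx M *m A *m M) (adjmx M *m B *m M).
Proof. by move=> AB v; rewrite !qform_congr. Qed.

Lemma lemx_congr_rpow n (A B P : 'M[C]_n) r : posdef P -> lemx A B ->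
  lemx (rpow P r *m A *m rpow P r) (rpow P r *m B *m rpow P r).
Proof. by move=> Pp /(lemx_congr (rpow P r)); rewrite adjmx_rpow. Qed.

Lemma qform_posdef_ge0 n (A : 'M[C]_n) v : posdef A -> 0 <= qform A v.
Proof.
move=> [_ Ap]; have [->|/Ap/ltW //] := eqVneq v 0.
by rewrite /qform mulmx0 mxE.
Qed.

Lemma posdef1 n : posdef (1%:M : 'M[C]_n).
Proof.
have U1 : Defs.unitarymx (1%:M : 'M[C]_n) by rewrite /Defs.unitarymx adjmx1 mulmx1.
by rewrite -(udiag1 U1 (d := fun=> 1)) //; exact: posdef_udiag.
Qed.

(* With Z' the adjoint of Z: 1 - Z Z' = (1 - Z Z')^2 + Z (1 - Z' Z) Z' *)
Lemma contraction_adj n (Z : 'M[C]_n) :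
  lemx (adjmx Z *m Z) 1%:M -> lemx (Z *m adjmx Z) 1%:M.
Proof.
move=> ZZ v; rewrite -subr_ge0 -qformB.
pose N := 1%:M - Z *m adjmx Z.
have -> : 1%:M - Z *m adjmx Z = adjmx N *m 1%:M *m N +
    adjmx (adjmx Z) *m (1%:M - adjmx Z *m Z) *m adjmx Z.
  rewrite /N adjmxB adjmx1 adjmxM !adjmxK mulmx1.
  rewrite !mulmxBl !mulmxBr !mul1mx !mulmx1 !mulmxA.
  by rewrite mulmxBl subrK.
rewrite qformD !qform_congr addr_ge0 ?(qform_posdef_ge0 _ (posdef1 n)) //.
by rewrite qformB subr_ge0.
Qed.

(* A^-1 - B^-1 = (A^-1 - B^-1) A (A^-1 - B^-1) + B^-1 (B - A) B^-1 *)
Lemma lemx_inv n (A B : 'M[C]_n) : posdef A -> posdef B -> lemx A B ->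
  lemx (rpow B (-1)) (rpow A (-1)).
Proof.
move=> Ap Bp AB v; rewrite -subr_ge0 -qformB.
set A' := rpow A (-1); set B' := rpow B (-1).
have AA : A *m A' = 1%:M by rewrite -{1}(rpow1 Ap) rpowK.
have AA' : A' *m A = 1%:M by rewrite -[X in _ *m X](rpow1 Ap) rpowVK.
have BB : B *m B' = 1%:M by rewrite -{1}(rpow1 Bp) rpowK.
pose N := A' - B'.
have N_adj : adjmx N = N by rewrite /N adjmxB /A' /B' !adjmx_rpow.
have -> : A' - B' = adjmx N *m A *m N + adjmx B' *m (B - A) *m B'.
  rewrite N_adj [adjmx B']adjmx_rpow // /N.
  rewrite !mulmxBl !mulmxBr !mulmxBl AA' -!mulmxA AA BB !mulmx1 !mul1mx.
  by rewrite subrK.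
rewrite qformD !qform_congr addr_ge0 ?(qform_posdef_ge0 _ Ap) //.
by rewrite qformB subr_ge0.
Qed.

(** The squared modulus of the i-th coordinate of [v] in the basis of columns of [U], written so as
    to live in [R]. *)
Definition coef2 n (U : 'M[C]_n) (v : 'cV[C]_n) i : R :=
  complex.Re ((adjmx U *m v) i 0) ^+ 2 + complex.Im ((adjmx U *m v) i 0) ^+ 2.

Lemma coef2_ge0 n (U : 'M[C]_n) v i : 0 <= coef2 U v i.
Proof. by rewrite addr_ge0 ?sqr_ge0. Qed.

Lemma qform_udiag n (U : 'M[C]_n) d v :
  qform (udiag U d) v = (\sum_i coef2 U v i * d i)%:C.
Proof.
rewrite /udiag -{1}[U]adjmxK qform_congr /qform /coef2.
move: (adjmx U *m v) => w; rewrite -mulmxA mxE rmorph_sum.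
apply: eq_bigr => i _.
by rewrite mul_diag_mx rmorphM /= add_Re2_Im2 normCK /adjmx !mxE /=; ring.
Qed.

Lemma lemx_udiag_id n (U : 'M[C]_n) d c : Defs.unitarymx U ->
  lemx (udiag U d) (c%:C%:M) <-> forall i, d i <= c.
Proof.
move=> Uu.
have cE : (c%:C%:M : 'M_n) = udiag U (fun=> c).
  have := scale_udiag U (fun=> 1) c; rewrite udiag1 // scalemx1 => ->.
  by apply: eq_udiag => i; rewrite mulr1.
rewrite cE; split=> [dc i | dc v]; last first.
  by rewrite !qform_udiag lecR ler_sum // => i _; rewrite ler_wpM2l // coef2_ge0.
(* At the i-th column of [U] only the i-th coefficient survives, which isolates [d i]. *)
have := dc (U *m delta_mx i 0); rewrite !qform_udiag lecR /coef2.
rewrite mulmxA unitarymx_adjl // mul1mx.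
rewrite (bigD1 i) //= [X in _ + X]big1 => [|j ji]; last first.
  by rewrite mxE (negbTE ji) /= expr0n addr0 mul0r.
rewrite (bigD1 i) //= [X in _ <= _ + X]big1 => [|j ji]; last first.
  by rewrite mxE (negbTE ji) /= expr0n addr0 mul0r.
by rewrite mxE !eqxx /= expr0n expr1n !addr0 !mul1r.
Qed.

End LoewnerOrder.

(** * Loewner-Heinz at dyadic exponents *)

Section LoewnerHeinz.
Variable R : realType.
Local Notation C := R[i].

Lemma rpowDr m n (B : 'M[C]_(m, n)) (A : 'M[C]_n) r s : posdef A ->
  B *m rpow A r *m rpow A s = B *m rpow A (r + s).
Proof. by move=> Ap; rewrite -mulmxA rpowD. Qed.

(** Conjugating [X^r <= Y^r] by [Y^(-r/2)] gives [Z' Z <= 1], with [Z'] the adjoint of [Z]. *)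
Lemma lemx_contraction n (X Y : 'M[C]_n) r : posdef X -> posdef Y ->
  lemx (rpow X r) (rpow Y r) ->
  let Z := rpow X (r / 2) *m rpow Y (- (r / 2)) in lemx (adjmx Z *m Z) 1%:M.
Proof.
move=> Xp Yp XY /=; rewrite adjmxM !adjmx_rpow // mulmxA rpowDr // -splitr.
have <- : rpow Y (- (r / 2)) *m rpow Y r *m rpow Y (- (r / 2)) = 1%:M.
  by rewrite !rpowD // -(rpow0 Yp); congr rpow; lra.
exact: lemx_congr_rpow.
Qed.

(* An eigenvalue of N is an eigenvalue of the contraction M, hence at most 1. *)
Lemma lemx_similar_contraction n (N M E : 'M[C]_n) : posdef N -> E \in unitmx ->
  E *m N = M *m E -> lemx (adjmx M *m M) 1%:M -> lemx N 1%:M.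
Proof.
move=> /posdef_spectral [U [d [Uu d0 NE]]] Eu EN Mc.
have UU := unitarymx_adjl Uu.
rewrite {}NE in EN *; apply/(lemx_udiag_id d 1 Uu) => i.
pose u : 'cV[C]_n := U *m delta_mx i 0.
have Nu : udiag U d *m u = (d i)%:C *: u.
  rewrite /udiag /u -!mulmxA (mulmxA (adjmx U) U) UU mul1mx scalemxAr.
  congr (_ *m _); rewrite /rdiag mul_diag_mx; apply/colP=> j; rewrite !mxE.
  by case: eqP => [->|]; rewrite ?mulr0.
have u0 : u != 0.
  apply/eqP => /(congr1 (mulmx (adjmx U))).
  rewrite /u mulmxA UU mul1mx mulmx0 => /matrixP /(_ i 0).
  by rewrite !mxE !eqxx => /eqP; rewrite oner_eq0.
have Eu0 : E *m u != 0.
  by apply: contraNneq u0 => Eu0; rewrite -(mulKmx Eu u) Eu0 mulmx0.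
move: Nu u0 Eu0; move: u => u Nu u0 Eu0.
have := Mc (E *m u); rewrite -[adjmx M]mulmx1 qform_congr mulmxA -EN.
rewrite -mulmxA Nu -scalemxAr.
have -> : qform 1%:M ((d i)%:C *: (E *m u)) = (d i ^+ 2)%:C * qform 1%:M (E *m u).
  rewrite /qform !mulmx1 -scalemxAr mxE.
  have -> : adjmx ((d i)%:C *: (E *m u)) = (d i)%:C *: adjmx (E *m u).
    by apply/matrixP=> a b; rewrite !mxE rmorphM /= conj_realC.
  by rewrite -scalemxAl mxE mulrA -rmorphM.
have [_ /(_ _ Eu0) q0] := posdef1 R n.
rewrite -[X in _ <= X -> _]mul1r ler_pM2r // (lecR (d i ^+ 2) 1).
by rewrite -[X in _ <= X -> _](expr1n _ 2) ler_sqr ?nnegrE // ltW.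
Qed.

(** By [contraction_adj], [Z Z' <= 1], hence [W' Z Z' W <= W' W <= 1]. *)
Lemma contraction_mul_adj n (Z W : 'M[C]_n) :
  lemx (adjmx Z *m Z) 1%:M -> lemx (adjmx W *m W) 1%:M ->
  lemx (adjmx (adjmx Z *m W) *m (adjmx Z *m W)) 1%:M.
Proof.
move=> /contraction_adj /(lemx_congr W); rewrite mulmx1 adjmxM adjmxK !mulmxA.
exact: lemx_trans.
Qed.

(** With [h] the midpoint, the two hypotheses give contractions whose product is
    [M = Y^(-r/2) X^h Y^(-s/2)]. It is similar to the positive definite [N = Y^(-h/2) X^h Y^(-h/2)],
    so [N <= 1], and conjugation by [Y^(h/2)] concludes. *)
Lemma lowner_heinz_midpoint n (X Y : 'M[C]_n) r s : posdef X -> posdef Y ->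
  lemx (rpow X r) (rpow Y r) -> lemx (rpow X s) (rpow Y s) ->
  lemx (rpow X ((r + s) / 2)) (rpow Y ((r + s) / 2)).
Proof.
move=> Xp Yp XYr XYs; have [h hE] : exists h, h = (r + s) / 2 by eexists.
rewrite -hE.
have Np := posdef_congr_rpow (- (h / 2)) (rpow_posdef h Xp) Yp.
have Mc := contraction_mul_adj (lemx_contraction Xp Yp XYr)
  (lemx_contraction Xp Yp XYs).
have N1 : lemx (rpow Y (- (h / 2)) *m rpow X h *m rpow Y (- (h / 2))) 1%:M.
  (* With [E = Y^((s-r)/4)], both [E N] and [M E] equal [Y^(-r/2) X^h Y^(-h/2)]. *)
  apply: lemx_similar_contraction (rpow_unit ((s - r) / 4) Yp) _ Mc => //.
  rewrite adjmxM !adjmx_rpow // !mulmxA rpowD // !rpowDr //.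
  by congr (rpow _ _ *m rpow _ _ *m rpow _ _); rewrite hE; lra.
have := lemx_congr_rpow (h / 2) Yp N1.
rewrite !mulmxA mulmx1 (rpowK (h / 2) Yp) mul1mx.
by rewrite -mulmxA (rpowVK (h / 2) Yp) mulmx1 (rpowD _ _ Yp) -splitr.
Qed.

Lemma midpoint_dyadic (S : R -> Prop) : S 0 -> S 1 ->
  (forall x y, S x -> S y -> S ((x + y) / 2)) ->
  forall k m, (m <= 2 ^ k)%N -> S (m%:R / 2 ^+ k).
Proof.
move=> S0 S1 Sm; elim=> [|k IH] m.
  by case: m => [|[|//]] _; rewrite expr0 divr1.
(* A dyadic of level k+1 is the midpoint of two of level k, with numerators m/2 rounded down and
   up. *)
move=> mk; have -> : m%:R / 2 ^+ k.+1 =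
    (m./2%:R / 2 ^+ k + (uphalf m)%:R / 2 ^+ k) / 2 :> R.
  rewrite -mulrDl -natrD addnC uphalf_half -addnA addnn odd_double_half.
  by rewrite exprS invfM; ring.
rewrite expnS mul2n in mk.
apply: Sm; apply: IH.
  by rewrite -(doubleK (2 ^ k)%N) half_leq.
by rewrite leq_uphalf_double.
Qed.

End LoewnerHeinz.

(** * Loewner-Heinz for all exponents in [0, 1], by continuity *)

Section LoewnerHeinzContinuity.
Variable R : realType.
Local Notation C := R[i].
Local Open Scope classical_set_scope.

Lemma continuous_ge0_dyadic (f : R -> R) : continuous f ->
  (forall k m, (m <= 2 ^ k)%N -> 0 <= f (m%:R / 2 ^+ k)) ->
  forall r, 0 <= r <= 1 -> 0 <= f r.
Proof.
move=> fc f0 r /andP[r0 r1]; rewrite leNgt; apply/negP => fr.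
have /nbhs_ballP [e /= e0 fe] : \forall x \near r, f x < 0.
  exact: (cvgr_lt _ (fc r) _ fr).
(* Since [1/e < k < 2^k], dyadics of level [k] are spaced more finely than the radius [e] on which
   [f] is negative. *)
pose k := Num.bound e^-1; pose N : R := 2 ^+ k.
have N0 : 0 < N by rewrite exprn_gt0.
have Ne : N^-1 < e.
  rewrite -[e]invrK ltf_pV2 ?posrE ?invr_gt0 //.
  apply: (@lt_trans _ _ k%:R).
    by apply: archi_boundP; rewrite invr_ge0 ltW.
  by rewrite /N -natrX ltr_nat ltn_expl.
(* [m / N] is the last dyadic of level [k] not above [r], so it falls in the ball and contradicts
   [f0]. *)
pose m := Num.truncn (r * N).
have /andP[m1 m2] := Num.Theory.truncn_itv (mulr_ge0 r0 (ltW N0)).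
have mr : m%:R / N <= r by rewrite ler_pdivrMr.
have mr' : r - m%:R / N < e.
  apply: lt_trans Ne; rewrite ltrBlDr -(ltr_pM2r N0) mulrDl.
  by rewrite mulVf ?gt_eqF // divfK ?gt_eqF // addrC natr1.
have /f0 : (m <= 2 ^ k)%N.
  rewrite -(ler_nat R) natrX (le_trans m1) // -[X in _ <= X]mul1r ler_wpM2r //.
  exact: ltW.
apply/negP; rewrite -ltNge; apply: fe.
by rewrite /ball /= ger0_norm // subr_ge0.
Qed.

Lemma continuous_sum_powR n (c d : 'I_n -> R) : (forall i, 0 < d i) ->
  continuous (fun r => \sum_i c i * powR (d i) r).
Proof.
move=> d0; apply: continuous_big => [|i _ r]; first exact: add_continuous.
apply: cvgM; first exact: cvg_cst.
rewrite /powR gt_eqF //.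
apply: continuous_comp; last exact: continuous_expR.
by apply: cvgM; [exact: cvg_id | exact: cvg_cst].
Qed.

Theorem lowner_heinz n (X Y : 'M[C]_n) r : posdef X -> posdef Y ->
  lemx X Y -> 0 <= r <= 1 -> lemx (rpow X r) (rpow Y r).
Proof.
move=> Xp Yp XY r01.
have dya := midpoint_dyadic (S := fun r => lemx (rpow X r) (rpow Y r)) _ _
  (fun x y => @lowner_heinz_midpoint R n X Y x y Xp Yp).
move: dya; rewrite !rpow0 // !rpow1 // => /(_ (@lemx_refl _ _ _) XY).
have /posdef_spectral [U [d [Uu d0 ->]]] := Xp.
have /posdef_spectral [V [e [Vu e0 ->]]] := Yp.
move=> dya v; rewrite !rpow_udiag // !qform_udiag lecR -subr_ge0.
(* For a fixed [v] the gap between the two forms is a continuous real function of the exponent. *)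
pose f s := \sum_i coef2 V v i * powR (e i) s - \sum_i coef2 U v i * powR (d i) s.
apply: (@continuous_ge0_dyadic f) => // [s | k m mk].
  by apply: cvgB; exact: continuous_sum_powR.
have := dya k m mk v; rewrite !rpow_udiag // !qform_udiag lecR -subr_ge0.
by [].
Qed.

End LoewnerHeinzContinuity.

(** * Bounds on powers of G, and the normalized claim *)

Section SpectralMean.
Variable R : realType.
Local Notation C := R[i].

Lemma rpow_add n (A : 'M[C]_n) r s u : posdef A -> r + s = u ->
  rpow A r *m rpow A s = rpow A u.
Proof. by move=> Ap <-; exact: rpowD. Qed.

Lemma rpow_mul n (A : 'M[C]_n) r s u : posdef A -> r * s = u ->
  rpow (rpow A r) s = rpow A u.
Proof. by move=> Ap <-; exact: rpowM. Qed.

Lemma rpow_le1 n (M : 'M[C]_n) q : posdef M -> 0 <= q ->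
  lemx M 1%:M -> lemx (rpow M q) 1%:M.
Proof.
move=> /posdef_spectral [U [d [Uu d0 ->]]] q0 /(lemx_udiag_id d 1 Uu) d1.
rewrite rpow_udiag //; apply/(lemx_udiag_id _ 1 Uu) => i.
have := ge0_ler_powR q0 (ltW (d0 i)) ler01 (d1 i).
by rewrite powR1.
Qed.

Lemma lemx_inv_rpow n (A B : 'M[C]_n) r s r' s' : posdef A -> posdef B ->
  r + r' = 0 -> s + s' = 0 ->
  lemx (rpow A r) (rpow B s) -> lemx (rpow B s') (rpow A r').
Proof.
move=> Ap Bp rr ss /(lemx_inv (rpow_posdef r Ap) (rpow_posdef s Bp)).
by rewrite (rpow_mul (u := s') Bp) ?(rpow_mul (u := r') Ap) //; lra.
Qed.

(** [Q] stands for [A^(1/2) B A^(1/2)]. The equations say [h = 1/2], [h' = -1/2] and [u = 2 - 1/t],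
    a form suited to linear arithmetic on exponents. *)
Lemma gmean_pos_bound n (A Q : 'M[C]_n) t u h h' : posdef A -> posdef Q ->
  h + h = 1 -> h + h' = 0 -> 0 < t <= h -> (2 - u) * t = 1 ->
  lemx Q (rpow A u) ->
  lemx (rpow (rpow A h' *m rpow Q h *m rpow A h') (t + t)) (rpow A (-1)).
Proof.
move=> Ap Qp hh hh' /andP[t0 th] ut QA.
have Kp := rpow_posdef h Qp.
have Gp := posdef_congr_rpow h' Kp Ap.
have h01 : 0 <= h <= 1 by apply/andP; split; lra.
have := lowner_heinz Qp (rpow_posdef u Ap) QA h01.
rewrite (rpow_mul Ap (erefl (u * h))).
move=> /(lemx_congr_rpow h' Ap); rewrite (rpow_add Ap (erefl (h' + u * h))).
rewrite (rpow_add Ap (erefl (h' + u * h + h'))) => GA.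
have t01 : 0 <= t + t <= 1 by apply/andP; split; lra.
have := lowner_heinz Gp (rpow_posdef _ Ap) GA t01.
(* The exponent is [(u/2 - 1) * 2t = (u - 2) t = -1]. *)
rewrite (rpow_mul (u := -1) Ap) //.
have -> : h = 1 / 2 by lra.
have -> : h' = - (1 / 2) by lra.
by move: ut; lra.
Qed.

(** The case [t = -s], where [u = 2 + 1/s]. *)
Lemma gmean_neg_bound n (A Q : 'M[C]_n) s u h h' : posdef A -> posdef Q ->
  h + h = 1 -> h + h' = 0 -> 0 < s <= 1 -> (u - 2) * s = 1 ->
  lemx (rpow A u) Q ->
  lemx A (rpow (rpow A h' *m rpow Q h *m rpow A h') (s + s)).
Proof.
move=> Ap Qp hh hh' /andP[s0 s1] us AQ.
have Kp := rpow_posdef h Qp.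
have Gp := posdef_congr_rpow h' Kp Ap.
have [G GE] : exists G, G = rpow A h' *m rpow Q h *m rpow A h' by eexists.
have s1_gt0 : 0 < s + s + 1 by lra.
have s1_neq0 : s + s + 1 != 0 by rewrite gt_eqF.
have [a aE] : exists a, a = s / (s + s + 1) by eexists.
have a_mul : a * (s + s + 1) = s by rewrite aE divfK.
have a01 : 0 <= a <= 1.
  rewrite aE divr_ge0 ?(ltW s0) ?(ltW s1_gt0) //= ler_pdivrMr //; lra.
(* Both sides times [s] agree, as [u s = 2s + 1]. *)
have ua : u * a = 1.
  by apply: (mulIf (lt0r_neq0 s0)); rewrite -mulrA; nra.
have b01 : 0 <= 1 - a <= 1 by move: a01; lra.
have Aa : lemx A (rpow Q a).
  have := lowner_heinz (rpow_posdef u Ap) Qp AQ a01.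
  by rewrite (rpow_mul Ap ua) rpow1.
have Ab : lemx (rpow A (u - 1)) (rpow Q (1 - a)).
  have := lowner_heinz (rpow_posdef u Ap) Qp AQ b01.
  by rewrite (rpow_mul (u := u - 1) Ap) //; move: ua; lra.
have Qa : lemx (rpow Q (- a)) (rpow A (-1)).
  by apply: (lemx_inv_rpow (r := 1) (s := a)); rewrite ?rpow1 ?subrr.
have GG : lemx (rpow A (u - 2)) (G *m G).
  have -> : G *m G = rpow A h' *m (rpow Q h *m rpow A (-1) *m rpow Q h) *m rpow A h'.
    rewrite GE !mulmxA -[_ *m rpow A h' *m rpow A h']mulmxA.
    by rewrite (rpow_add (u := -1) Ap) //; lra.
  (* First [A^-1] is bounded below by [Q^(-a)]; the resulting [Q^(1-a)] is then bounded below by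
     [A^(u-1)]. *)
  apply: lemx_trans (lemx_congr_rpow h' Ap (lemx_congr_rpow h Qp Qa)).
  rewrite (rpow_add Qp (erefl (h + - a))) (rpow_add (u := 1 - a) Qp); last lra.
  apply: lemx_trans (lemx_congr_rpow h' Ap Ab).
  rewrite (rpow_add Ap (erefl (h' + (u - 1)))) (rpow_add (u := u - 2) Ap).
    exact: lemx_refl.
  by lra.
rewrite -GE; rewrite -GE in Gp.
have G2 : G *m G = rpow G (1 + 1) by rewrite -(rpowD _ _ Gp) rpow1.
rewrite G2 in GG.
have s01 : 0 <= s <= 1 by rewrite ltW.
have := lowner_heinz (rpow_posdef _ Ap) (rpow_posdef _ Gp) GG s01.
by rewrite (rpow_mul Ap us) (rpow1 Ap) (rpow_mul (u := s + s) Gp) // mulrDl mul1r.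
Qed.

Lemma gmean_invE n (A B : 'M[C]_n) h h' : posdef A -> posdef B ->
  h = 1 / 2 -> h + h' = 0 ->
  gmean (invmx A) B =
    rpow A h' *m rpow (rpow A h *m B *m rpow A h) h *m rpow A h'.
Proof.
move=> Ap Bp hE hh'; rewrite /gmean -hE !mpowE invmx_posdef //.
have E1 : -1 * h = h' by lra.
have E2 : -1 * - h = h by lra.
by rewrite (rpow_mul Ap E1) (rpow_mul Ap E2).
Qed.

Lemma gmean_posdef n (A B : 'M[C]_n) : posdef A -> posdef B ->
  posdef (gmean (invmx A) B).
Proof.
move=> Ap Bp; have [h hE] : exists h : R, h = 1 / 2 by eexists.
rewrite (gmean_invE Ap Bp hE (subrr h)).
exact: (posdef_congr_rpow _ (rpow_posdef _ (posdef_congr_rpow _ Bp Ap)) Ap).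
Qed.

Lemma sptE n (A B : 'M[C]_n) t : spt t A B =
  rpow (gmean (invmx A) B) t *m A *m rpow (gmean (invmx A) B) t.
Proof. by rewrite /spt mpowE. Qed.

Lemma spt_posdef n (A B : 'M[C]_n) t : posdef A -> posdef B -> posdef (spt t A B).
Proof.
move=> Ap Bp; rewrite sptE.
exact: (posdef_congr_rpow _ Ap (gmean_posdef Ap Bp)).
Qed.

Lemma spt_le1 n (A B : 'M[C]_n) t p : posdef A -> posdef B ->
  -1 <= t <= 1 / 2 -> t != 0 -> p * (t + t) = 1 - t ->
  lemx (rpow (rpow A p *m B *m rpow A p) t) 1%:M -> lemx (spt t A B) 1%:M.
Proof.
move=> Ap Bp /andP[t1 t2] t0 pt.
have [h hE] : exists h : R, h = 1 / 2 by eexists.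
have [h' hh'] : exists h' : R, h + h' = 0 by exists (- h); rewrite subrr.
have hh : h + h = 1 by lra.
(* Since [p = (1-t)/(2t)], this is [u = 2 - 1/t]. *)
have [u uE] : exists u, u = 1 - (p + p) by eexists.
have ut : (2 - u) * t = 1 by move: pt; rewrite uE; lra.
have Mp := posdef_congr_rpow p Bp Ap.
rewrite sptE (gmean_invE Ap Bp hE hh').
move: Mp; have [M ME] : exists M, M = rpow A p *m B *m rpow A p by eexists.
rewrite -ME => Mp Mt.
have Qp := posdef_congr_rpow h Bp Ap.
have [Q QE] : exists Q, Q = rpow A h *m B *m rpow A h by eexists.
rewrite -QE in Qp *.
(* Congruence by [A^(1/2-p)] sends [M] to [Q] and the identity to [A^u], so a comparison of [M] with
   1 becomes one of [Q] with [A^u]. *)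
have Mh : rpow A (h - p) *m M *m rpow A (h - p) = Q.
  rewrite ME QE !mulmxA (rpow_add (u := h) Ap); last lra.
  by rewrite -mulmxA (rpow_add (u := h) Ap); last lra.
have Ah : rpow A (h - p) *m 1%:M *m rpow A (h - p) = rpow A u.
  by rewrite mulmx1 (rpow_add (u := u) Ap) // uE; lra.
have Gp := posdef_congr_rpow h' (rpow_posdef h Qp) Ap.
have [t_gt0|t_le0] := ltP 0 t.
  have M1 : lemx M 1%:M.
    have tV : 0 <= t^-1 by rewrite invr_ge0 ltW.
    have := rpow_le1 (rpow_posdef t Mp) tV Mt.
    by rewrite (rpow_mul Mp (mulfV t0)) (rpow1 Mp).
  have QA : lemx Q (rpow A u).
    by have := lemx_congr_rpow (h - p) Ap M1; rewrite Mh Ah.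
  have th : 0 < t <= h by rewrite t_gt0 hE.
  have := gmean_pos_bound Ap Qp hh hh' th ut QA.
  move: Gp; move: (_ *m _ *m _) => G Gp.
  (* Inverting [G^(2t) <= A^-1] gives [A <= G^(-2t)], and congruence by [G^t] finishes. *)
  move=> /(lemx_inv_rpow Gp Ap (subrr (t + t)) (addNr 1)).
  move=> /(lemx_congr_rpow t Gp); rewrite (rpow1 Ap).
  rewrite (rpow_add (u := - t) Gp); last lra.
  by rewrite (rpow_add (u := 0) Gp) ?addNr // rpow0.
have t_lt0 : t < 0 by rewrite lt_neqAle t0.
(* For [t < 0] the nonnegative exponent [-1/t] turns [M^t <= 1] into [M^-1 <= 1], which is then
   inverted. *)
have M1 : lemx 1%:M M.
  have tV : 0 <= - t^-1 by rewrite oppr_ge0 invr_le0 ltW.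
  have := rpow_le1 (rpow_posdef t Mp) tV Mt.
  rewrite (rpow_mul (u := -1) Mp); last by rewrite mulrN mulfV.
  rewrite -(rpow0 Mp).
  by move=> /(lemx_inv_rpow Mp Mp (addNr 1) (addr0 0)); rewrite (rpow1 Mp).
have AQ : lemx (rpow A u) Q.
  by have := lemx_congr_rpow (h - p) Ap M1; rewrite Mh Ah.
have s01 : 0 < - t <= 1 by apply/andP; split; lra.
have us : (u - 2) * - t = 1 by move: ut; lra.
have := gmean_neg_bound Ap Qp hh hh' s01 us AQ.
move: Gp; move: (_ *m _ *m _) => G Gp.
move=> /(lemx_congr_rpow t Gp).
rewrite (rpow_add (u := - t) Gp); last lra.
by rewrite (rpow_add (u := 0) Gp) ?addNr // rpow0.
Qed.

End SpectralMean.

(** * Scaling [B] to pass from the bound 1 to any bound [c] *)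

Section Homogeneity.
Variable R : realType.
Local Notation C := R[i].

Lemma lemx_scale1 n (X : 'M[C]_n) c : 0 < c ->
  lemx (c^-1%:C *: X) 1%:M <-> lemx X c%:C%:M.
Proof.
move=> c0; have cV : (c^-1)%:C * c%:C = 1 by rewrite -rmorphM mulVf ?gt_eqF.
have cV0 : 0 < (c^-1)%:C :> C by rewrite ltcR invr_gt0.
have E v : (qform (c^-1%:C *: X) v <= qform 1%:M v) = (qform X v <= qform c%:C%:M v).
  by rewrite -(ler_pM2l cV0 (qform X v)) -!qformZ scale_scalar_mx cV.
by split=> le v; have := le v; rewrite E.
Qed.

Lemma mulmx_scale_mid n (P M : 'M[C]_n) c : P *m (c *: M) *m P = c *: (P *m M *m P).
Proof. by rewrite -scalemxAr -scalemxAl. Qed.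

Lemma gmean_invZ n (A B : 'M[C]_n) h b : posdef A -> posdef B -> h = 1 / 2 -> 0 < b ->
  gmean (invmx A) (b%:C *: B) = (powR b h)%:C *: gmean (invmx A) B.
Proof.
move=> Ap Bp hE b0; have bBp := posdefZ Bp b0.
rewrite (gmean_invE Ap Bp hE (subrr h)) (gmean_invE Ap bBp hE (subrr h)).
have Qp := posdef_congr_rpow h Bp Ap.
by rewrite mulmx_scale_mid (rpowZ h Qp b0) mulmx_scale_mid.
Qed.

(** Scaling [B] by [b] scales G by [b^(1/2)], and [G^t] occurs twice. *)
Lemma sptZ n (A B : 'M[C]_n) t b : posdef A -> posdef B -> 0 < b ->
  spt t A (b%:C *: B) = (powR b t)%:C *: spt t A B.
Proof.
move=> Ap Bp b0; have [h hE] : exists h : R, h = 1 / 2 by eexists.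
have Gp := gmean_posdef Ap Bp.
rewrite !sptE (gmean_invZ Ap Bp hE b0) (rpowZ t Gp (powR_gt0 h b0)).
rewrite -!scalemxAl -scalemxAr scalerA -rmorphM -powRrM -powRD.
  by congr (_%:C *: _); congr powR; rewrite hE; lra.
by rewrite (gt_eqF b0) implybT.
Qed.

Lemma spt_le n (A B : 'M[C]_n) t p c : posdef A -> posdef B ->
  -1 <= t <= 1 / 2 -> t != 0 -> p * (t + t) = 1 - t -> 0 < c ->
  lemx (rpow (rpow A p *m B *m rpow A p) t) c%:C%:M -> lemx (spt t A B) c%:C%:M.
Proof.
move=> Ap Bp t1 t0 pt c0.
(* With [b = c^(-1/t)], replacing [B] by [b B] multiplies both matrices by [b^t = 1/c]. *)
have [b b0 bt] : exists2 b, 0 < b & powR b t = c^-1.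
  exists (powR c (- t^-1)); first exact: powR_gt0.
  by rewrite -powRrM mulNr mulVf // powR_inv1 // ltW.
have Mp := posdef_congr_rpow p Bp Ap.
move=> /(lemx_scale1 _ c0) Mc; apply/(lemx_scale1 _ c0).
rewrite -bt -sptZ //; apply: (spt_le1 Ap (posdefZ Bp b0) t1 t0 pt).
by rewrite mulmx_scale_mid (rpowZ t Mp b0) bt.
Qed.

End Homogeneity.

(** * The Cauchy-Binet formula *)

Section CauchyBinet.
Variables (F : comPzRingType) (n k : nat) (x0 : 'I_n).

Definition ksets : {set {set 'I_n}} := [set s : {set 'I_n} | #|s| == k].

(* The increasing enumeration of a [k]-subset; [x0] is a junk value that is
   never reached for [s \in ksets]. *)
Definition kenum (s : {set 'I_n}) (i : 'I_k) : 'I_n := nth x0 (enum s) i.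

Lemma size_kset s : s \in ksets -> size (enum s) = k.
Proof. by rewrite inE -cardE => /eqP. Qed.

Lemma kenum_inj s : s \in ksets -> injective (kenum s).
Proof.
move=> /size_kset sk i j /eqP; rewrite /kenum nth_uniq ?sk ?enum_uniq //.
by move=> /eqP /val_inj.
Qed.

Lemma kenum_in s i : s \in ksets -> kenum s i \in s.
Proof. by move=> /size_kset sk; rewrite -mem_enum mem_nth // sk. Qed.

Lemma kenum_imset s : s \in ksets -> [set kenum s i | i : 'I_k] = s.
Proof.
move=> sk; apply/eqP; rewrite eqEcard; apply/andP; split.
  by apply/fintype.subsetP=> x /imsetP[i _ ->]; exact: kenum_in.
rewrite card_imset; last exact: kenum_inj.
by rewrite card_ord; move: sk; rewrite inE => /eqP ->.
Qed.

Lemma det_mulmx_ffun (A : 'M[F]_(k, n)) (B : 'M[F]_(n, k)) :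
  \det (A *m B) = \sum_(f : {ffun 'I_k -> 'I_n} | injectiveb f)
    (\prod_i A i (f i)) * \det (rowsub f B).
Proof.
transitivity (\sum_(f : {ffun 'I_k -> 'I_n}) (\prod_i A i (f i)) * \det (rowsub f B)).
  pose AB (s : 'S_k) i j := A i j * B j (s i).
  transitivity (\sum_(f : {ffun 'I_k -> 'I_n}) \sum_(s : 'S_k)
      (-1) ^+ s * \prod_i AB s i (f i)).
    rewrite exchange_big; apply: eq_bigr => /= s _; rewrite -big_distrr /=.
    congr (_ * _); rewrite -(bigA_distr_bigA (AB s)) /=.
    by apply: eq_bigr => x _; rewrite mxE.
  apply: eq_bigr => f _; rewrite big_distrr /=; apply: eq_bigr => s _.
  rewrite mulrCA big_split //=; congr (_ * (_ * _)).
  by apply: eq_bigr => x _; rewrite mxE.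
(* A non-injective [f] selects a row of [B] twice, so its determinant vanishes. *)
rewrite (bigID (fun f : {ffun 'I_k -> 'I_n} => injectiveb f)) /=.
rewrite [X in _ + X]big1 ?addr0 // => f /injectivePn [i1 [i2 Di12 Ef12]].
by rewrite (determinant_alternate Di12) ?mulr0 // => j; rewrite !mxE Ef12.
Qed.

(** Injective maps are grouped by their image [s]; those with image [s] are [kenum s] composed with
    a permutation, and summing over the permutations rebuilds the minor of [A]. *)
Lemma cauchy_binet (A : 'M[F]_(k, n)) (B : 'M[F]_(n, k)) :
  \det (A *m B) =
    \sum_(s in ksets) \det (colsub (kenum s) A) * \det (rowsub (kenum s) B).
Proof.
rewrite det_mulmx_ffun.
rewrite (partition_big (fun f : {ffun 'I_k -> 'I_n} => [set f i | i : 'I_k])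
  (mem ksets)) /=; last first.
  by move=> f /injectiveP finj; rewrite inE card_imset // card_ord.
apply: eq_bigr => s sk.
pose toF (u : 'S_k) : {ffun 'I_k -> 'I_n} := [ffun i => kenum s (u i)].
have toF_inj u : injective (toF u).
  by move=> i j; rewrite !ffunE => /(kenum_inj sk) /perm_inj.
pose idx (x : 'I_n) (i : 'I_k) : 'I_k := insubd i (index x (enum s)).
have idxK x i : x \in s -> kenum s (idx x i) = x.
  move=> xs; rewrite /kenum /idx val_insubd.
  have -> : (index x (enum s) < k)%N.
    by rewrite -[X in (_ < X)%N](size_kset sk) index_mem mem_enum.
  by rewrite nth_index // mem_enum.
have fin (f : {ffun 'I_k -> 'I_n}) i : [set f i | i : 'I_k] == s -> f i \in s.
  by move=> /eqP <-; apply: imset_f.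
(* The permutation underlying [f]; the default 1 is never reached when [f] is injective with values
   in [s]. *)
pose ofF (f : {ffun 'I_k -> 'I_n}) : 'S_k :=
  insubd (1%g : 'S_k) [ffun i => idx (f i) i].
have ofFE (f : {ffun 'I_k -> 'I_n}) : injective f -> (forall i, f i \in s) ->
    forall i, kenum s (ofF f i) = f i.
  move=> finj fs i; pose g := [ffun i => idx (f i) i].
  have ginj : injectiveb g.
    apply/injectiveP => a b; rewrite !ffunE => /(congr1 (kenum s)).
    by rewrite !idxK // => /finj.
  rewrite -pvalE; have -> : pval (ofF f) = g.
    exact: (@insubdK _ _ {perm 'I_k} 1%g g ginj).
  by rewrite ffunE idxK.
rewrite (reindex_onto toF ofF) /=; last first.
  move=> f /andP[/injectiveP finj fs]; apply/ffunP => i.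
  by rewrite ffunE ofFE // => j; exact: fin.
transitivity (\sum_(u : 'S_k) (\prod_i A i (kenum s (u i))) *
   \det (rowsub (kenum s \o u) B)).
  apply: eq_big => [u | u _]; last first.
    congr (_ * _); first by apply: eq_bigr => i _; rewrite ffunE.
    by congr (\det _); apply/matrixP => i j; rewrite !mxE ffunE.
  apply/andP; split; first (apply/andP; split; first exact/injectiveP).
    rewrite -[X in _ == X](kenum_imset sk); apply/eqP/setP => x.
    apply/imsetP/imsetP => [[i _ ->] | [i _ ->]].
      by exists (u i); rewrite ?ffunE.
    by exists (u^-1%g i); rewrite ?ffunE ?permKV.
  apply/eqP/permP => i; apply: (kenum_inj sk).
  by rewrite ofFE ?ffunE // => j; rewrite ffunE kenum_in.
rewrite big_distrl /=; apply: eq_bigr => u _.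
(* Sorting the rows of [B] costs the sign of [u], which completes the Leibniz term for [A]. *)
have -> : rowsub (kenum s \o u) B = row_perm u (rowsub (kenum s) B).
  by apply/matrixP=> i j; rewrite !mxE.
rewrite row_permE det_mulmx det_perm mulrA; congr (_ * _); rewrite mulrC.
by congr (_ * _); apply: eq_bigr => i _; rewrite mxE.
Qed.

End CauchyBinet.

(** * Compound matrices and their compatibility with powers and means *)

Section Compound.
Variables (R : realType) (n k : nat) (x0 : 'I_n).
Local Notation C := R[i].
Local Notation N := #|ksets n k|.

Definition kidx (i : 'I_N) : 'I_k -> 'I_n := kenum x0 (enum_val i).

(** The k-th compound, with k-subsets numbered so that it is an ordinary square matrix to which the
    results above apply. *)
Definition compound (M : 'M[C]_n) : 'M[C]_N :=
  \matrix_(i, j) \det (mxsub (kidx i) (kidx j) M).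

Lemma compoundM (A B : 'M[C]_n) : compound (A *m B) = compound A *m compound B.
Proof.
apply/matrixP=> i j; rewrite !mxE.
have -> : mxsub (kidx i) (kidx j) (A *m B) = rowsub (kidx i) A *m colsub (kidx j) B.
  by apply/matrixP=> a b; rewrite !mxE; apply: eq_bigr => l _; rewrite !mxE.
rewrite (cauchy_binet x0) big_enum_val; apply: eq_bigr => l _; rewrite !mxE.
by congr (_ * _); congr determinant; apply/matrixP=> a b; rewrite !mxE.
Qed.

Lemma compound_adj (A : 'M[C]_n) : compound (adjmx A) = adjmx (compound A).
Proof.
apply/matrixP=> i j; rewrite !mxE -det_map_mx -det_tr.
by congr (\det _); apply/matrixP=> a b; rewrite !mxE.
Qed.

Lemma compound_rdiag (d : 'I_n -> R) :
  compound (rdiag d) = rdiag (fun i => \prod_j d (kidx i j)).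
Proof.
apply/matrixP=> i j; rewrite rdiagE mxE.
have [<-|ij] := eqVneq i j.
  rewrite mulr1n rmorph_prod /=.
  have -> : mxsub (kidx i) (kidx i) (rdiag d) = rdiag (d \o kidx i).
    by apply/matrixP=> a b; rewrite mxE !rdiagE (inj_eq (kenum_inj (enum_valP i))).
  by rewrite det_diag; apply: eq_bigr => l _; rewrite mxE.
rewrite mulr0n.
(* Distinct k-sets have equal size, so the first has an element outside the second; it gives a zero
   row in the minor. *)
have [a aj] : exists a, kidx i a \notin (enum_val j : {set 'I_n}).
  apply/existsP; apply: contraNT ij => /existsPn sub.
  apply/eqP/enum_val_inj/eqP; rewrite eqEcard; apply/andP; split.
    rewrite -(kenum_imset x0 (enum_valP i)); apply/fintype.subsetP => x.
    by move=> /imsetP[b _ ->]; apply/negbNE/sub.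
  by have := enum_valP i; have := enum_valP j; rewrite !inE => /eqP -> /eqP ->.
rewrite (expand_det_row _ a) big1 // => b _; rewrite mxE rdiagE.
suff /negbTE -> : kidx i a != kidx j b by rewrite mulr0n mul0r.
by apply: contraNneq aj => ->; exact: kenum_in (enum_valP j).
Qed.

Lemma compound1 : compound 1%:M = 1%:M.
Proof.
have <- : rdiag (fun=> 1) = 1%:M :> 'M[C]_n by apply: rdiag1.
by rewrite compound_rdiag rdiag1 // => i; rewrite big1.
Qed.

Lemma compound_unitary (U : 'M[C]_n) : Defs.unitarymx U ->
  Defs.unitarymx (compound U).
Proof. by move=> Uu; rewrite /Defs.unitarymx -compound_adj -compoundM Uu compound1. Qed.

Lemma compound_udiag (U : 'M[C]_n) d :
  compound (udiag U d) = udiag (compound U) (fun i => \prod_j d (kidx i j)).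
Proof. by rewrite /udiag !compoundM compound_adj compound_rdiag. Qed.

Lemma compound_posdef (A : 'M[C]_n) : posdef A -> posdef (compound A).
Proof.
move=> /posdef_spectral [U [d [Uu d0 ->]]]; rewrite compound_udiag.
apply: posdef_udiag; first exact: compound_unitary.
by move=> i; apply: prodr_gt0.
Qed.

Lemma compound_rpow (A : 'M[C]_n) r : posdef A ->
  compound (rpow A r) = rpow (compound A) r.
Proof.
move=> /posdef_spectral [U [d [Uu d0 ->]]].
rewrite (rpow_udiag r Uu d0) !compound_udiag (rpow_udiag r (compound_unitary Uu)).
  by apply: eq_udiag => i; rewrite prod_powR // => j; exact: ltW.
by move=> i; apply: prodr_gt0.
Qed.

Lemma compound_gmean_inv (A B : 'M[C]_n) : posdef A -> posdef B ->
  compound (gmean (invmx A) B) = gmean (invmx (compound A)) (compound B).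
Proof.
move=> Ap Bp; have [h hE] : exists h : R, h = 1 / 2 by eexists.
have [LAp LBp] := (compound_posdef Ap, compound_posdef Bp).
rewrite (gmean_invE Ap Bp hE (subrr h)) (gmean_invE LAp LBp hE (subrr h)).
rewrite !compoundM (compound_rpow _ Ap) (compound_rpow h) ?compoundM.
  by rewrite (compound_rpow _ Ap).
exact: posdef_congr_rpow.
Qed.

Lemma compound_spt (A B : 'M[C]_n) t : posdef A -> posdef B ->
  compound (spt t A B) = spt t (compound A) (compound B).
Proof.
move=> Ap Bp; rewrite !sptE !compoundM (compound_rpow t (gmean_posdef Ap Bp)).
by rewrite (compound_gmean_inv Ap Bp).
Qed.

End Compound.

(** * Sorted eigenvalues, and the largest eigenvalue of a compound *)

Section Eigenvalues.
Variable R : realType.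
Local Notation C := R[i].

Lemma char_poly_udiag n (U : 'M[C]_n) d : Defs.unitarymx U ->
  char_poly (udiag U d) = \prod_(i < n) ('X - ((d i)%:C)%:P).
Proof.
move=> Uu; pose P := map_mx polyC U; pose P' := map_mx polyC (adjmx U).
have PP : P *m P' = 1%:M by rewrite -map_mxM Uu map_mx1.
have E : char_poly_mx (udiag U d) = P *m char_poly_mx (rdiag d) *m P'.
  rewrite /char_poly_mx mulmxBr mulmxBl -!map_mxM; congr (_ - _).
  by rewrite mul_mx_scalar -scalemxAl PP scalemx1.
rewrite /char_poly E !det_mulmx mulrAC -det_mulmx PP det1 mul1r.
have -> : rdiag d = diag_mx (\row_i (d i)%:C) by [].
rewrite -/(char_poly _) char_poly_trig ?diag_mx_is_trig //.
by apply: eq_bigr => i _; rewrite !mxE eqxx mulr1n.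
Qed.

Lemma nonincreasing_root_unique n (d e : 'I_n -> R) :
  (forall i j : 'I_n, (i <= j)%N -> d j <= d i) ->
  (forall i j : 'I_n, (i <= j)%N -> e j <= e i) ->
  \prod_(i < n) ('X - ((d i)%:C)%:P) = \prod_(i < n) ('X - ((e i)%:C)%:P) ->
  d =1 e.
Proof.
move=> dd de E.
pose s (f : 'I_n -> R) := [seq f i | i <- enum 'I_n].
have sE f : \prod_(i < n) ('X - ((f i)%:C)%:P) =
    \prod_(x <- [seq y%:C | y <- s f]) ('X - x%:P) :> {poly C}.
  by rewrite /s 2!big_map big_enum.
have s_sorted f : (forall i j : 'I_n, (i <= j)%N -> f j <= f i) ->
    sorted >=%R (s f).
  move=> fd; rewrite /s sorted_map.
  have : sorted leq (map val (enum 'I_n)) by rewrite val_enum_ord iota_sorted.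
  by rewrite sorted_map; apply: sub_sorted => i j /= ij; exact: fd.
(* Equal products of linear factors have the same multiset of roots, and sorting leaves one
   listing. *)
have : perm_eq (s d) (s e).
  by apply: (perm_map_inj (@complexI R)); apply: prod_XsubC_eq; rewrite -!sE.
move=> /(sorted_eq ge_trans ge_anti (s_sorted d dd) (s_sorted e de)) /eq_in_map.
by move=> de' i; apply: de'; rewrite mem_enum.
Qed.

Lemma udiag_perm n (U : 'M[C]_n) d (p : 'S_n) :
  udiag (col_perm p U) (d \o p) = udiag U d.
Proof.
apply/matrixP=> i j; rewrite /udiag /rdiag !mul_mx_diag !mxE.
rewrite [RHS](reindex_perm p); apply: eq_bigr => l _.
by rewrite !mxE.
Qed.

Lemma posdef_spectral_sorted n (A : 'M[C]_n) : posdef A ->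
  exists (U : 'M[C]_n) (d : 'I_n -> R),
    [/\ Defs.unitarymx U, (forall i, 0 < d i),
        (forall i j : 'I_n, (i <= j)%N -> d j <= d i) & A = udiag U d].
Proof.
move=> /posdef_spectral [U [d [Uu d0 ->]]].
pose t := [tuple d i | i < n].
have /tuple_permP [p pE] : perm_eq (sort >=%R t) t by rewrite perm_sort.
have srt : sorted >=%R (sort >=%R t) by apply: sort_sorted => x y; exact: ge_total.
exists (col_perm p U), (d \o p); split.
- have := udiag_perm U (fun=> 1) p; rewrite [RHS]udiag1 //.
  by rewrite /udiag rdiag1 // mulmx1.
- by move=> i; exact: d0.
- move=> i j ij /=.
  have nthE (l : 'I_n) : nth 0 (sort >=%R t) l = d (p l).
    by rewrite pE -(tnth_nth 0 [tuple tnth t (p i) | i < n] l) !tnth_mktuple.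
  rewrite -!nthE; apply: (sorted_leq_nth ge_trans ge_refl) => //;
    by rewrite inE size_sort size_tuple.
- by rewrite udiag_perm.
Qed.

Lemma eigval_udiag n (U : 'M[C]_n) d : Defs.unitarymx U ->
  (forall i j : 'I_n, (i <= j)%N -> d j <= d i) -> eigval (udiag U d) =1 d.
Proof.
move=> Uu dd; rewrite /eigval; case: pselect => [h|]; last first.
  by case; exists d; split=> //; exact: char_poly_udiag.
case: (cid h) => /= e [de ee]; apply: nonincreasing_root_unique => //.
by rewrite -ee char_poly_udiag.
Qed.

Lemma eigval_gt0 n (A : 'M[C]_n) i : posdef A -> 0 < eigval A i.
Proof.
by move=> /posdef_spectral_sorted [U [d [Uu d0 dd ->]]]; rewrite eigval_udiag.
Qed.

(** A strictly increasing sequence of naturals, indexed from 0, is at least its index. *)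
Lemma leq_kenum n k (x0 : 'I_n) (s : {set 'I_n}) (i : 'I_k) : s \in ksets n k ->
  (i <= kenum x0 s i)%N.
Proof.
move=> sk; have srt : sorted ltn (map val (enum s)).
  rewrite sorted_map /enum_mem; apply: sorted_filter.
    by move=> a b c; exact: ltn_trans.
  by rewrite -enumT -sorted_map val_enum_ord iota_ltn_sorted.
have sz : size (map val (enum s)) = k by rewrite size_map (size_kset sk).
have -> : kenum x0 s i = nth 0%N (map val (enum s)) i :> nat.
  by rewrite (nth_map x0) // (size_kset sk).
have : (i < size (map val (enum s)))%N by rewrite sz.
elim: (i : nat) => // m IH mlt; apply: leq_ltn_trans (IH (ltnW mlt)) _.
by apply: (sorted_ltn_nth ltn_trans 0%N srt) => //; rewrite inE // ltnW.
Qed.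

(** The eigenvalues of the compound are the products of [d] over k-sets, and the largest comes from
    the first k indices. *)
Lemma compound_le n k (x0 : 'I_n) (A : 'M[C]_n) c : posdef A -> (k <= n)%N ->
  lemx (compound k x0 A) c%:C%:M <-> \prod_(j < n | (j < k)%N) eigval A j <= c.
Proof.
move=> /posdef_spectral_sorted [U [d [Uu d0 dd ->]]] kn.
rewrite compound_udiag (lemx_udiag_id _ _ (compound_unitary k x0 Uu)).
under eq_bigr => j _ do rewrite (eigval_udiag Uu dd).
split=> [dc | dc i].
  pose s : {set 'I_n} := [set j : 'I_n | (j < k)%N].
  have sk : s \in ksets n k.
    rewrite inE -sum1_card (eq_bigl (fun j : 'I_n => (j < k)%N)) => [|j].
      by rewrite (big_ord_narrow kn) sum1_card card_ord.
    by rewrite inE.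
  have := dc (enum_rank_in sk s); rewrite /kidx enum_rankK_in //.
  suff -> : \prod_(j < n | (j < k)%N) d j = \prod_(j < k) d (kenum x0 s j) by [].
  transitivity (\prod_(j in [set kenum x0 s i | i : 'I_k]) d j).
    by apply: eq_bigl => j; rewrite kenum_imset // inE.
  by rewrite big_imset //= => a b _ _; exact: kenum_inj.
(* Factor by factor: [d] is nonincreasing and the j-th element of a k-set is at least [j]. *)
apply: le_trans dc; rewrite (big_ord_narrow kn); apply: ler_prod => j _.
rewrite ltW //=; apply: dd; exact: leq_kenum (enum_valP i).
Qed.

End Eigenvalues.

(** * Determinants, and the log-majorization itself *)

Section LogMajorization.
Variable R : realType.
Local Notation C := R[i].

Lemma det_rpow_expR n (A : 'M[C]_n) : posdef A -> exists a : R,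
  \det A = (expR a)%:C /\ forall r, \det (rpow A r) = (expR (a * r))%:C.
Proof.
move=> /det_rpow [x x0 [dA dAr]]; exists (ln x).
by split=> [|r]; rewrite ?expRM lnK ?posrE.
Qed.

Lemma det_rpow_of n (A : 'M[C]_n) a r : posdef A -> \det A = (expR a)%:C ->
  \det (rpow A r) = (expR (a * r))%:C.
Proof.
by move=> /det_rpow_expR [x [-> ->]] /complexI /expR_inj ->.
Qed.

(** With [a] and [b] the logarithms of the determinants of [A] and [B], both sides have logarithm
    [a (1 - t) + b t]. *)
Lemma det_spt n (A B : 'M[C]_n) t p : posdef A -> posdef B ->
  p * (t + t) = 1 - t ->
  \det (spt t A B) = \det (rpow (rpow A p *m B *m rpow A p) t).
Proof.
move=> Ap Bp pt; have [h hE] : exists h : R, h = 1 / 2 by eexists.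
have [a [dA dAr]] := det_rpow_expR Ap; have [b [dB _]] := det_rpow_expR Bp.
have dQ : \det (rpow A h *m B *m rpow A h) = (expR (a + b))%:C.
  rewrite !det_mulmx dAr dB -!rmorphM -!expRD; congr (expR _)%:C; rewrite hE; lra.
have Qp := posdef_congr_rpow h Bp Ap.
have dG : \det (gmean (invmx A) B) = (expR ((b - a) * h))%:C.
  rewrite (gmean_invE Ap Bp hE (subrr h)) !det_mulmx dAr (det_rpow_of h Qp dQ).
  by rewrite -!rmorphM -!expRD; congr (expR _)%:C; rewrite hE; lra.
have dM : \det (rpow A p *m B *m rpow A p) = (expR (a * p + b + a * p))%:C.
  by rewrite !det_mulmx dAr dB -!rmorphM -!expRD.
rewrite (det_rpow_of t (posdef_congr_rpow p Bp Ap) dM) sptE !det_mulmx dA.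
rewrite (det_rpow_of t (gmean_posdef Ap Bp) dG) -!rmorphM -!expRD.
congr (expR _)%:C; have -> : a * p + b + a * p = a * (p + p) + b by ring.
have -> : (a * (p + p) + b) * t = a * (p * (t + t)) + b * t by ring.
by rewrite pt hE; lra.
Qed.

End LogMajorization.

Theorem theorem4p8 (R : realType) (n : nat) (A B : 'M[R[i]]_n) (t : R) :
  posdef A -> posdef B -> -1 <= t <= 1/2 -> t != 0 ->
  logmaj (spt t A B)
    (mpow (mpow A ((1 - t) / (2 * t)) *m B *m mpow A ((1 - t) / (2 * t))) t).
Proof.
move=> Ap Bp t1 t0; rewrite !mpowE.
have [p pE] : exists p, p = (1 - t) / (2 * t) by eexists.
have pt : p * (t + t) = 1 - t.
  by rewrite pE -mulr2n -[t *+ 2]mulr_natl divfK // mulf_neq0 // pnatr_eq0.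
rewrite -pE; have Mp := posdef_congr_rpow p Bp Ap.
split; last exact: det_spt.
move=> k /andP[k1 kn].
have n0 : (0 < n)%N by case: (n) kn => //; case: (k) k1.
have kn' : (k <= n)%N := leq_trans kn (leq_pred n).
pose x0 := Ordinal n0.
(* The claim for [k] now says that the compound of the left side is at most [c] times the
   identity. *)
set c := (X in _ <= X).
have c0 : 0 < c by apply: prodr_gt0 => j _; apply/eigval_gt0/rpow_posdef.
apply/(compound_le x0 c (spt_posdef t Ap Bp) kn').
rewrite (compound_spt k x0 t Ap Bp).
have [LAp LBp] := (compound_posdef k x0 Ap, compound_posdef k x0 Bp).
(* The order bound is applied to the compounds of [A] and [B]; its hypothesis holds by the choice of
   [c]. *)
apply: (spt_le LAp LBp t1 t0 pt c0).
have := (compound_le x0 c (rpow_posdef t Mp) kn').2 (lexx c).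
by rewrite (compound_rpow k x0 t Mp) !compoundM (compound_rpow k x0 p Ap).
Qed.
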